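(* Let $\varphi_0$ and $\varphi_1$ be the morphisms over the alphabet $\{a,b,c\}$ defined by \[ \varphi_0:\ a\mapsto abc,\quad b\mapsto a,\quad c\mapsto ac, \qquad\text{and}\qquad \varphi_1:\ a\mapsto cba,\quad b\mapsto a,\quad c\mapsto ca, \] and let $\mathbf{u}_0=\varphi_0(\mathbf{u}_0)=abcaacabcabcacabc\ldots$ and $\mathbf{u}_1=\varphi_1(\mathbf{u}_1)=cacbacaacbacacbac\ldots$ be their respective one-sided infinite fixed points. Then there is no initial balanced pair for $(\mathbf{u}_0,\mathbf{u}_1)$, i.e. for all integers $n>0$, \[ \mathbf{1}(\mathbf{u}_0[{:}n])\neq \mathbf{1}(\mathbf{u}_1[{:}n]). \]
   Context: For an alphabet (finite set) $\mathcal{A}$, $\mathcal{A}^*$ is the set of finite words over $\mathcal{A}$ and $\mathcal{A}^{\mathbb{N}}$ the set of one-sided infinite sequences, indexed from $0$. A morphism on $\mathcal{A}$, given by its values on letters, is extended to $\mathcal{A}^*$ by $\varphi(uv)=\varphi(u)\varphi(v)$ and to $\mathcal{A}^{\mathbb{N}}$ by concatenating the images of letters. Each of the two morphisms above has a unique fixed point in $\{a,b,c\}^{\mathbb{N}}$. For a sequence (or word) $u=u_0u_1u_2\cdots$, $u[{:}n]=u_0u_1\cdots u_{n-1}$ denotes its prefix of length $n$. For a finite word $u$ and a letter $x$, $|u|_x$ is the number of occurrences of $x$ in $u$; over the ordered alphabet $\{a,b,c\}$, $\mathbf{1}(u)=(|u|_a,|u|_b,|u|_c)\in\mathbb{N}^3$.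 A pair $(u,v)$ of (nonempty) finite words is a balanced pair if $\mathbf{1}(u)=\mathbf{1}(v)$. An initial balanced pair for $(\mathbf{u}_0,\mathbf{u}_1)$ is a balanced pair $(u,v)$ such that $u$ is a prefix of $\mathbf{u}_0$ and $v$ is a prefix of $\mathbf{u}_1$. *)

(* Defs.v *)
From HB Require Import structures.
From mathcomp Require Import all_boot.

Set Implicit Arguments.
Unset Strict Implicit.
Unset Printing Implicit Defensive.

Variant letter := La | Lb | Lc.

Definition ord_of_letter (x : letter) : 'I_3 :=
  match x with
  | La => @Ordinal 3 0 isT
  | Lb => @Ordinal 3 1 isT
  | Lc => @Ordinal 3 2 isT
  end.

Definition letter_of_ord (i : 'I_3) : letter :=
  match val i with 0 => La | 1 => Lb | _ => Lc end.

Lemma ord_of_letterK : cancel ord_of_letter letter_of_ord.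
Proof. by case. Qed.

HB.instance Definition _ := Finite.copy letter (can_type ord_of_letterK).

Section Words.
Variable A : Type.
Implicit Types (phi : A -> seq A) (w : seq A) (u : nat -> A).

Definition pref u (n : nat) : seq A := mkseq u n.

Definition word_prefix w u : Prop := w = pref u (size w).

Definition morph_word phi w : seq A := flatten (map phi w).

(* The images of the first n.+1 letters of u already contain the letter of
   index n of the image of u, provided no letter has an empty image; see
   [morph_seq_prefix].  In that case the default [u n] is never used. *)
Definition morph_seq phi u : nat -> A :=
  fun n => nth (u n) (morph_word phi (pref u n.+1)) n.

Definition fixed_point phi u : Prop := morph_seq phi u =1 u.

Definition nonerasing phi : Prop := forall x, 0 < size (phi x).

Lemma morph_word_cat phi w1 w2 :
  morph_word phi (w1 ++ w2) = morph_word phi w1 ++ morph_word phi w2.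
Proof. by rewrite /morph_word map_cat flatten_cat. Qed.

Lemma size_morph_word phi w : nonerasing phi -> size w <= size (morph_word phi w).
Proof.
move=> ne; elim: w => //= x w IH.
by rewrite /morph_word /= size_cat -add1n leq_add.
Qed.

Lemma pref_cat u m n : m <= n -> exists w, pref u n = pref u m ++ w.
Proof.
move=> /subnKC <-; rewrite /pref /mkseq iotaD map_cat.
by eexists.
Qed.

Lemma nth_morph_pref phi u x y m n i :
    i < size (morph_word phi (pref u m)) ->
    i < size (morph_word phi (pref u n)) ->
  nth x (morph_word phi (pref u m)) i = nth y (morph_word phi (pref u n)) i.
Proof.
wlog le_mn : x y m n / m <= n => [hw | ] im jn.
  by case: (leqP m n) => [|/ltnW] le; [|symmetry]; apply: hw.
have [w ew] := pref_cat u le_mn.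
by rewrite ew morph_word_cat nth_cat im; apply: set_nth_default.
Qed.

Lemma morph_seq_prefix phi u n :
  nonerasing phi -> word_prefix (morph_word phi (pref u n)) (morph_seq phi u).
Proof.
move=> ne; apply: (@eq_from_nth _ (u 0)) => [|i lt_i]; first by rewrite size_mkseq.
rewrite nth_mkseq //; apply: nth_morph_pref => //.
by apply: leq_trans (size_morph_word _ ne); rewrite size_mkseq.
Qed.

Lemma fixed_point_exists phi x w :
    nonerasing phi -> 0 < size w -> phi x = x :: w ->
  exists u, fixed_point phi u.
Proof.
move=> ne w0 phx; pose W k := iter k (morph_word phi) [:: x].
have WS k : W k.+1 = morph_word phi (W k) by [].
have Wcat k d : exists v, W (k + d) = W k ++ v.
  elim: k d => [|k IH] d; last first.
    have [v ev] := IH d; exists (morph_word phi v).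
    by rewrite addSn !WS ev morph_word_cat.
  elim: d => [|d [v ev]]; first by exists [::].
  exists (w ++ morph_word phi v).
  by rewrite addnS WS ev morph_word_cat /morph_word /= cats0 phx.
have Wsz k : k < size (W k).
  elim: k => // k IH.
  have [v ev] := Wcat 0 k; move: IH; rewrite add0n in ev.
  rewrite WS ev morph_word_cat /= ltnS => hk.
  rewrite /morph_word /= cats0 phx size_cat /= addSn ltnS.
  apply: leq_trans (leq_add w0 (size_morph_word v ne)).
  by rewrite add1n ltnS.
pose u i := nth x (W i) i; exists u.
have Wu i k : i <= k -> nth x (W k) i = u i.
  by move=> /subnKC <-; have [v ->] := Wcat i (k - i); rewrite nth_cat Wsz.
have uW n : pref u n = take n (W n).
  apply: (@eq_from_nth _ x) => [|i].
    by rewrite size_mkseq size_takel // ltnW.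
  by rewrite size_mkseq => lt_in; rewrite nth_mkseq // nth_take // Wu // ltnW.
move=> i; rewrite /morph_seq.
have lt_i : i < size (morph_word phi (pref u i.+1)).
  by apply: leq_trans (size_morph_word _ ne); rewrite size_mkseq.
rewrite (set_nth_default x) // -(@Wu i i.+2) ?leqW //.
rewrite WS -(cat_take_drop i.+1 (W i.+1)) -uW.
by rewrite morph_word_cat nth_cat lt_i.
Qed.

Lemma fixed_point_unique phi u v :
    nonerasing phi -> 1 < size (phi (u 0)) ->
    fixed_point phi u -> fixed_point phi v -> u 0 = v 0 -> u =1 v.
Proof.
move=> ne s2 fu fv e0.
suff H n : pref u n.+1 = pref v n.+1.
  move=> n; have := congr1 (fun s => nth (u 0) s n) (H n).
  by rewrite !nth_mkseq.
elim: n => [|n IH]; first by rewrite /pref /mkseq /= e0.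
have sz : n.+1 < size (morph_word phi (pref u n.+1)).
  rewrite /morph_word /pref /mkseq /= size_cat.
  apply: leq_trans (leq_add s2 (size_morph_word _ ne)).
  by rewrite size_map size_iota.
have sz' t : n.+1 < size (morph_word phi (pref t n.+2)).
  by apply: leq_trans (size_morph_word _ ne); rewrite size_mkseq.
have prefS t : pref t n.+2 = rcons (pref t n.+1) (t n.+1).
  by rewrite /pref /mkseq -(addn1 n.+1) iotaD map_cat cats1.
rewrite !prefS IH -fu -fv /morph_seq; congr rcons.
rewrite (nth_morph_pref _ (u 0) (sz' u) sz) IH.
by apply: nth_morph_pref => //; rewrite -IH.
Qed.

End Words.

Definition parikh (w : seq letter) : nat * nat * nat :=
  (count_mem La w, count_mem Lb w, count_mem Lc w).

Definition balanced_pair (u v : seq letter) : Prop :=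
  [/\ u <> [::], v <> [::] & parikh u = parikh v].

Definition initial_balanced_pair (s t : nat -> letter) (u v : seq letter) : Prop :=
  [/\ balanced_pair u v, word_prefix u s & word_prefix v t].

Definition phi0 (x : letter) : seq letter :=
  match x with
  | La => [:: La; Lb; Lc]
  | Lb => [:: La]
  | Lc => [:: La; Lc]
  end.

Definition phi1 (x : letter) : seq letter :=
  match x with
  | La => [:: Lc; Lb; La]
  | Lb => [:: La]
  | Lc => [:: Lc; La]
  end.

Lemma phi0_fixed_point_exists : exists u, fixed_point phi0 u.
Proof. by apply: (@fixed_point_exists _ _ La [:: Lb; Lc]) => //; case. Qed.

Lemma phi1_fixed_point_exists : exists u, fixed_point phi1 u.
Proof. by apply: (@fixed_point_exists _ _ Lc [:: La]) => //; case. Qed.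

Lemma phi0_fixed_point_unique u v :
  fixed_point phi0 u -> fixed_point phi0 v -> u =1 v.
Proof.
have z s : fixed_point phi0 s -> s 0 = La.
  by move=> /(_ 0); rewrite /morph_seq /morph_word /pref /mkseq /=; case: (s 0).
move=> fu fv; apply: (@fixed_point_unique _ phi0) => //; first by case.
  by rewrite (z u).
by rewrite (z u) // (z v).
Qed.

Lemma phi1_fixed_point_unique u v :
  fixed_point phi1 u -> fixed_point phi1 v -> u =1 v.
Proof.
have z s : fixed_point phi1 s -> s 0 = Lc.
  by move=> /(_ 0); rewrite /morph_seq /morph_word /pref /mkseq /=; case: (s 0).
move=> fu fv; apply: (@fixed_point_unique _ phi1) => //; first by case.
  by rewrite (z u).
by rewrite (z u) // (z v).
Qed.

(* Main.v *)
Require Import Defs.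
From HB Require Import structures.
From mathcomp Require Import all_boot.
From mathcomp Require Import ssralg ssrnum ssrint zify.

Set Implicit Arguments.
Unset Strict Implicit.
Unset Printing Implicit Defensive.

(** Cut a pair of prefixes of the two fixed points along the images of letters:
    it comes from a shorter pair [(u, v)], whose difference of Parikh vectors
    [d] and next letters [(p, q)] determine, up to the choice of the positions
    in [phi0 p] and [phi1 q], the same data for the longer pair.  Starting from
    [d = 0] and [(p, q) = (a, c)], the data of all pairs other than the empty
    one lie either in regions that no transition leaves, in which [d] drifts to
    infinity along the dominant eigenvector, or in a finite set; [d = 0] belongs
    to none of these. *)

Lemma prefS (A : Type) (u : nat -> A) n : pref u n.+1 = rcons (pref u n) (u n).
Proof. by rewrite /pref /mkseq -addn1 iotaD map_cat cats1. Qed.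

Section Desubstitution.
Variables (A : Type) (phi : A -> seq A) (u : nat -> A).
Hypotheses (phi_ne : nonerasing phi) (u_fix : fixed_point phi u).

Lemma morph_word_pref m :
  morph_word phi (pref u m) = pref u (size (morph_word phi (pref u m))).
Proof. by rewrite {1}(morph_seq_prefix u m phi_ne); apply: eq_map. Qed.

Lemma morph_word_prefS m :
  morph_word phi (pref u m.+1) = morph_word phi (pref u m) ++ phi (u m).
Proof. by rewrite prefS -cats1 morph_word_cat /morph_word /= cats0. Qed.

Lemma cut_position n : exists m j,
  j < size (phi (u m)) /\ n = size (morph_word phi (pref u m)) + j.
Proof.
elim: n => [|n [m [j [lt_j ->]]]]; first by exists 0, 0; split.
case: (ltnP j.+1 (size (phi (u m)))) => [lt_j1|le_j].
  by exists m, j.+1; rewrite addnS.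
have /eqP ej : j.+1 == size (phi (u m)) by rewrite eqn_leq lt_j.
by exists m.+1, 0; split=> //; rewrite morph_word_prefS size_cat -ej addn0 addnS.
Qed.

(** The cut falls in the image of the letter that covers position [n]. The inequality makes the
    preimage strictly shorter when [n] is positive, as the induction on lengths requires; the last
    clause isolates the trivial cut. *)
Lemma desubstitution n : 1 < size (phi (u 0)) ->
  exists m j, [/\ j < size (phi (u m)), m + (0 < n) <= n,
    pref u n = morph_word phi (pref u m) ++ take j (phi (u m)),
    u n = nth (u m) (phi (u m)) j & (n == 0) = (m == 0) && (j == 0)].
Proof.
move=> long; have [m [j [lt_j en]]] := cut_position n; exists m, j.
have e := morph_word_pref m.+1; rewrite morph_word_prefS size_cat in e.
have lt_n : n < size (morph_word phi (pref u m)) + size (phi (u m)).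
  by rewrite en ltn_add2l.
(* The image of the first letter has at least two letters and every other image at least one; the
   surplus letter gives the strict decrease. *)
have le_m : m + (0 < m) <= size (morph_word phi (pref u m)).
  case: m {lt_j en e lt_n} => // m; rewrite /pref /mkseq /= size_cat addn1.
  rewrite -addn2 addnC; apply: leq_add => //.
  apply: leq_trans (size_morph_word _ phi_ne).
  by rewrite size_map size_iota.
split=> //.
- by lia.
- have -> : pref u n = take n (morph_word phi (pref u m) ++ phi (u m)).
    by rewrite e /pref /mkseq -map_take take_iota (minn_idPl (ltnW lt_n)).
  by rewrite take_cat en ltnNge leq_addr addKn.
- have -> : u n = nth (u m) (morph_word phi (pref u m) ++ phi (u m)) n.
    by rewrite e nth_mkseq.
  by rewrite nth_cat en ltnNge leq_addr addKn.
- by case: m {lt_j e lt_n} en le_m => [|m] -> //; lia.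
Qed.

End Desubstitution.

Lemma fixed_point_phi0_first u : fixed_point phi0 u -> u 0 = La.
Proof.
by move=> /(_ 0); rewrite /morph_seq /morph_word /pref /mkseq /=; case: (u 0).
Qed.

Lemma fixed_point_phi1_first u : fixed_point phi1 u -> u 0 = Lc.
Proof.
by move=> /(_ 0); rewrite /morph_seq /morph_word /pref /mkseq /=; case: (u 0).
Qed.

Lemma nonerasing_phi0 : nonerasing phi0. Proof. by case. Qed.

Lemma nonerasing_phi1 : nonerasing phi1. Proof. by case. Qed.

Local Open Scope ring_scope.

Definition count_diff (x : letter) (s t : seq letter) : int :=
  (count_mem x s)%:Z - (count_mem x t)%:Z.

Definition parikh_diff (s t : seq letter) : int * int * int :=
  (count_diff La s t, count_diff Lb s t, count_diff Lc s t).

(** The linear part is the incidence matrix. It is the same for [phi0] and [phi1], so the difference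
    of Parikh vectors evolves on its own, up to the contribution of the cut images. *)
Definition step (d : int * int * int) (s t : seq letter) : int * int * int :=
  let: (x, y, z) := d in
  (x + y + z + count_diff La s t, x + count_diff Lb s t,
   x + z + count_diff Lc s t).

Lemma parikh_phi0 w (n := fun x => count_mem x w) :
  parikh (morph_word phi0 w) = (n La + n Lb + n Lc, n La, n La + n Lc)%N.
Proof.
rewrite {}/n; elim: w => //= x w; rewrite /parikh /morph_word /= => -[ea eb ec].
by rewrite !count_cat ea eb ec; case: x => /=; congr (_, _, _); lia.
Qed.

Lemma parikh_phi1 w (n := fun x => count_mem x w) :
  parikh (morph_word phi1 w) = (n La + n Lb + n Lc, n La, n La + n Lc)%N.
Proof.
rewrite {}/n; elim: w => //= x w; rewrite /parikh /morph_word /= => -[ea eb ec].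
by rewrite !count_cat ea eb ec; case: x => /=; congr (_, _, _); lia.
Qed.

Lemma parikh_diff_step u v s t :
  parikh_diff (morph_word phi0 u ++ s) (morph_word phi1 v ++ t) =
  step (parikh_diff u v) s t.
Proof.
rewrite /parikh_diff /step /count_diff !count_cat.
have [-> -> ->] := parikh_phi0 u; have [-> -> ->] := parikh_phi1 v.
by rewrite /=; congr (_, _, _); lia.
Qed.

Definition escaped (d : int * int * int) : bool :=
  let: (x, y, z) := d in
  [|| [&& 1 <= x, 0 <= y & 0 <= z], [&& x <= -1, y <= 0 & z <= -1]
    | [&& x <= 0, y <= 1 & z <= -2]].

(* Computed as the states reachable from the empty pair, the empty pair itself
   excepted, before they escape. *)
Definition core (p q : letter) : seq (int * int * int) :=
  match p, q with
  | La, La => [:: (-1, 1, -1); (0, 0, -1); (0, 1, -1); (1, 0, -1); (1, 1, -1)]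
  | La, Lb => [:: (0, 1, -1); (1, 1, -1)]
  | La, Lc => [:: (-2, 1, -1); (-1, 1, -1); (0, 0, -1); (0, 1, 0)]
  | Lb, La => [:: (1, -1, -2); (1, 0, -1); (2, 0, -1)]
  | Lb, Lb => [:: (1, 0, -2); (1, 1, -1); (2, 1, -1)]
  | Lb, Lc => [:: (0, 0, -1); (1, 0, -1)]
  | Lc, La => [:: (1, 0, -2); (1, 1, -1); (2, 0, -1); (2, 1, -1)]
  | Lc, Lb => [:: (1, 1, -2); (1, 2, -1); (2, 1, -1); (2, 2, -1)]
  | Lc, Lc => [:: (0, 1, -1); (1, 0, -1); (1, 1, -1)]
  end%Z.

Definition reachable (d : int * int * int) (p q : letter) : bool :=
  escaped d || (d \in core p q).

(** A proper prefix of an image is empty, [a] or [ab] for [phi0], and empty, [c] or [cb] for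
    [phi1]. *)
Lemma count_diff_bounds p q i j
    (dc := fun x => count_diff x (take i (phi0 p)) (take j (phi1 q))) :
    (i < size (phi0 p))%N -> (j < size (phi1 q))%N ->
  [&& 0 <= dc La <= 1, -1 <= dc Lb <= 1 & -1 <= dc Lc <= 0].
Proof.
by rewrite {}/dc; case: p; case: q; case: i => [|[|[|]]] //;
  case: j => [|[|[|]]].
Qed.

(** Each of the three regions is preserved separately, whatever the letters: its thresholds absorb
    the worst contribution allowed by [count_diff_bounds]. *)
Lemma escaped_next d p q i j : escaped d ->
    (i < size (phi0 p))%N -> (j < size (phi1 q))%N ->
  escaped (step d (take i (phi0 p)) (take j (phi1 q))).
Proof.
case: d => [[x y] z] /= esc lt_i lt_j; have := count_diff_bounds lt_i lt_j.
by move: (count_diff La _ _) (count_diff Lb _ _) (count_diff Lc _ _); lia.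
Qed.

Lemma core_next d p q i j : d \in core p q ->
    (i < size (phi0 p))%N -> (j < size (phi1 q))%N ->
  reachable (step d (take i (phi0 p)) (take j (phi1 q)))
    (nth p (phi0 p) i) (nth q (phi1 q) j).
Proof.
(* For fixed letters and positions, this is a boolean test over a finite list. *)
move=> core_d lt_i lt_j; move: d core_d; apply/allP; move: lt_i lt_j.
by case: p; case: q; case: i => [|[|[|]]] //; case: j => [|[|[|]]] // _ _;
  vm_compute.
Qed.

Lemma reachable_next d p q i j : reachable d p q ->
    (i < size (phi0 p))%N -> (j < size (phi1 q))%N ->
  reachable (step d (take i (phi0 p)) (take j (phi1 q)))
    (nth p (phi0 p) i) (nth q (phi1 q) j).
Proof.
move=> /orP[esc|cor] lt_i lt_j; last exact: core_next.
by rewrite /reachable escaped_next.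
Qed.

(** The base case: the empty pair lies outside the invariant, so its outgoing transitions are
    checked apart, except the loop [i = j = 0] back to itself. *)
Lemma reachable_first i j : (i < 3)%N -> (j < 2)%N -> (0 < i + j)%N ->
  reachable (step 0 (take i (phi0 La)) (take j (phi1 Lc)))
    (nth La (phi0 La) i) (nth Lc (phi1 Lc) j).
Proof. by case: i => [|[|[|]]] //; case: j => [|[|]] // _ _ _; vm_compute. Qed.

Lemma reachable_neq0 p q : ~~ reachable (0, 0, 0) p q.
Proof. by case: p; case: q. Qed.

Local Close Scope ring_scope.

(** The two lengths are independent because prefixes of equal length may desubstitute to prefixes of
    different lengths. *)
Lemma reachable_prefixes u0 u1 (h0 : fixed_point phi0 u0)
    (h1 : fixed_point phi1 u1) n m : 0 < n + m ->
  reachable (parikh_diff (pref u0 n) (pref u1 m)) (u0 n) (u1 m).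
Proof.
have z0 := fixed_point_phi0_first h0; have z1 := fixed_point_phi1_first h1.
have [k] := ubnP (n + m); elim: k n m => // k IH n m le_k nm0.
have [|n' [i [lt_i le_n -> -> en]]] := desubstitution nonerasing_phi0 h0 n.
  by rewrite z0.
have [|m' [j [lt_j le_m -> -> em]]] := desubstitution nonerasing_phi1 h1 m.
  by rewrite z1.
rewrite parikh_diff_step.
(* If the shorter pair is empty, [en] and [em] exclude the trivial cut on both sides at once. *)
have [/eqP|n'm'0] := posnP (n' + m'); last first.
  by apply: reachable_next => //; apply: IH; lia.
rewrite addn_eq0 => /andP[/eqP n'0 /eqP m'0].
rewrite {}n'0 {}m'0 z0 z1 in lt_i lt_j en em *.
by apply: reachable_first => //; lia.
Qed.

Theorem theorem1 (u0 u1 : nat -> letter)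
    (h0 : fixed_point phi0 u0) (h1 : fixed_point phi1 u1) :
  (~ exists u v : seq letter, initial_balanced_pair u0 u1 u v) /\
  (forall n : nat, 0 < n -> parikh (pref u0 n) <> parikh (pref u1 n)).
Proof.
have unbalanced n m : 0 < n + m -> parikh (pref u0 n) <> parikh (pref u1 m).
  move=> /(reachable_prefixes h0 h1) + [ea eb ec].
  rewrite /parikh_diff /count_diff ea eb ec !GRing.subrr.
  exact/negP/reachable_neq0.
split=> [[u [v [[u0n _ e] pu pv]]]|n n0]; last first.
  by apply: unbalanced; rewrite addn_gt0 n0.
rewrite pu pv in e; apply: unbalanced e.
by case: u u0n {pu}.
Qed.
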